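(* Let $H_d^+$ be a discrete right Hamiltonian and fix $q_0$. For each $k$, let $$\mathcal{S}_d^k(p_k)=p_kq_k-\sum_{l=0}^{k-1}\left[p_{l+1}q_{l+1}-H_d^+(q_l,p_{l+1})\right],$$ obtained by evaluating the right-hand side along a solution of the right discrete Hamilton's equations $$q_{l+1}=D_2H_d^+(q_l,p_{l+1}),\qquad p_l=D_1H_d^+(q_l,p_{l+1}),$$ and viewed as a function of the momentum $p_k$ at the discrete end time $t_k$. Then these functions satisfy the discrete Type II Hamilton--Jacobi equation $$\mathcal{S}_d^{k+1}(p_{k+1})-\mathcal{S}_d^k(p_k)=H_d^+\left(D\mathcal{S}_d^k(p_k),p_{k+1}\right)-p_k\cdot D\mathcal{S}_d^k(p_k),$$ where $p_k,p_{k+1}$ are consecutive momenta along a solution of the right discrete Hamilton's equations with the given $q_0$.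
   Context: One works in canonical coordinates $(q,p)$ on $T^*Q$, where $Q$ is an $n$-dimensional configuration manifold (so $Q$ may be regarded as an open subset of $\mathbb{R}^n$ and $pq=p\cdot q=\sum_ip_iq^i$). A discrete right Hamiltonian is a differentiable real-valued function $H_d^+(q_k,p_{k+1})$ of a position and a momentum. $D_1,D_2$ are partial derivatives with respect to the first and second arguments, and $D\mathcal{S}_d^k$ is the derivative of $\mathcal{S}_d^k$ with respect to its argument $p_k$. With $q_0$ fixed, $\mathcal{S}_d^k(p_k)$ is the extremal (stationary) value, over discrete curves $\{(q_l,p_l)\}_{l=0}^k$ in $T^*Q$ with the given $q_0$ and $p_k$, of the discrete functional on the right-hand side of its definition. It is understood that for the $p_k$ considered there is a unique solution $\{(q_l,p_l)\}_{l=0}^{k}$ of the right discrete Hamilton's equations (for $l=0,\dots,k-1$) with the given $q_0$ and $p_k$, and that it depends differentiably on $p_k$, so that $\mathcal{S}_d^k$ is a well-defined differentiable function. *)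

(* Defs.v *)
From HB Require Import structures.
From mathcomp Require Import all_boot all_order all_algebra.
From mathcomp Require Import all_classical all_reals all_analysis.

Set Implicit Arguments.
Unset Strict Implicit.
Unset Printing Implicit Defensive.

Import Order.TTheory GRing.Theory Num.Theory.
Import numFieldNormedType.Exports.

Local Open Scope classical_set_scope.
Local Open Scope ring_scope.

(* Positions and momenta are both written as coordinate row vectors, so the
   derivative of a function of a momentum is again a row vector that can be
   fed in as a position, and conversely. *)

Definition dot (R : realType) (n : nat) (p q : 'rV[R]_n) : R :=
  \sum_(i < n) p 0 i * q 0 i.

Definition grad (R : realType) (n : nat) (f : 'rV[R]_n -> R) (x : 'rV[R]_n)
    : 'rV[R]_n :=
  \row_(i < n) 'D_(delta_mx 0 i) f x.

Definition D1 (R : realType) (n : nat) (H : 'rV[R]_n * 'rV[R]_n -> R)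
    (q p : 'rV[R]_n) : 'rV[R]_n :=
  grad (fun x => H (x, p)) q.

Definition D2 (R : realType) (n : nat) (H : 'rV[R]_n * 'rV[R]_n -> R)
    (q p : 'rV[R]_n) : 'rV[R]_n :=
  grad (fun y => H (q, y)) p.

(* [Q] is an open set of R^n, [T^*Q = Q * R^n]; [H] is a total function, of
   which only the values on [Q * R^n] matter. *)
Definition discrete_right_Hamiltonian (R : realType) (n : nat)
    (Q : set 'rV[R]_n) (H : 'rV[R]_n * 'rV[R]_n -> R) : Prop :=
  forall q p : 'rV[R]_n, Q q -> differentiable H (q, p).

(* [c l = (q_l, p_l)]; only the indices [l <= k] are relevant for a discrete
   curve with end time [t_k]. *)
Definition dcurve (R : realType) (n : nat) : Type :=
  nat -> 'rV[R]_n * 'rV[R]_n.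

Definition right_solution (R : realType) (n : nat) (Q : set 'rV[R]_n)
    (H : 'rV[R]_n * 'rV[R]_n -> R) (k : nat) (c : dcurve R n) : Prop :=
  (forall l, (l <= k)%N -> Q (c l).1) /\
  (forall l, (l < k)%N ->
     (c l.+1).1 = D2 H (c l).1 (c l.+1).2 /\
     (c l).2 = D1 H (c l).1 (c l.+1).2).

Definition bv_solution (R : realType) (n : nat) (Q : set 'rV[R]_n)
    (H : 'rV[R]_n * 'rV[R]_n -> R) (q0 : 'rV[R]_n) (k : nat)
    (pk : 'rV[R]_n) (c : dcurve R n) : Prop :=
  [/\ right_solution Q H k c, (c 0%N).1 = q0 & (c k).2 = pk].

Definition unique_bv_solution (R : realType) (n : nat) (Q : set 'rV[R]_n)
    (H : 'rV[R]_n * 'rV[R]_n -> R) (q0 : 'rV[R]_n) (k : nat)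
    (pk : 'rV[R]_n) : Prop :=
  (exists c, bv_solution Q H q0 k pk c) /\
  (forall c c', bv_solution Q H q0 k pk c -> bv_solution Q H q0 k pk c' ->
     forall l, (l <= k)%N -> c l = c' l).

(* A chosen solution: when [unique_bv_solution Q H q0 k pk] holds, its values at
   the indices [l <= k] do not depend on the choice. *)
Definition bv_sol (R : realType) (n : nat) (Q : set 'rV[R]_n)
    (H : 'rV[R]_n * 'rV[R]_n -> R) (q0 : 'rV[R]_n) (k : nat)
    (pk : 'rV[R]_n) : dcurve R n :=
  xget ((fun=> (0, 0)) : nat -> 'rV[R]_n * 'rV[R]_n)
    [set c : nat -> 'rV[R]_n * 'rV[R]_n | bv_solution Q H q0 k pk c].

Definition discrete_functional (R : realType) (n : nat)
    (H : 'rV[R]_n * 'rV[R]_n -> R) (k : nat) (c : dcurve R n) : R :=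
  dot (c k).2 (c k).1
  - \sum_(0 <= l < k) (dot (c l.+1).2 (c l.+1).1 - H ((c l).1, (c l.+1).2)).

Definition Sd (R : realType) (n : nat) (Q : set 'rV[R]_n)
    (H : 'rV[R]_n * 'rV[R]_n -> R) (q0 : 'rV[R]_n) (k : nat)
    (pk : 'rV[R]_n) : R :=
  discrete_functional H k (bv_sol Q H q0 k pk).

(* Main.v *)
(* Along solutions with fixed q_0, the variation of the action S_d^k telescopes
   to its boundary terms dp_k . q_k + p_0 . dq_0 by Hamilton's equations; since
   dq_0 = 0, D S_d^k(p_k) = q_k.  By uniqueness, S_d^{k+1}(p_{k+1}) and
   S_d^k(p_k) are partial actions of one and the same curve, so they differ by
   H(q_k, p_{k+1}) - p_k . q_k, in which q_k = D S_d^k(p_k). *)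

Require Import Defs.
From HB Require Import structures.
From mathcomp Require Import all_boot all_order all_algebra.
From mathcomp Require Import all_classical all_reals all_analysis.
From mathcomp Require Import ring.

Import Order.TTheory GRing.Theory Num.Theory.
Import numFieldNormedType.Exports.

Local Open Scope classical_set_scope.
Local Open Scope ring_scope.

Section Calculus.
Context {R : realType} {n : nat}.
Implicit Types (x v : 'rV[R]_n) (a b : 'rV[R]_n -> 'rV[R]_n).
Implicit Types H : 'rV[R]_n * 'rV[R]_n -> R.

Lemma dot_delta (i : 'I_n) (q : 'rV[R]_n) : dot (delta_mx 0 i) q = q 0 i.
Proof.
rewrite /dot (bigD1 i) //= mxE !eqxx mul1r big1 ?addr0 // => j ji.
by rewrite mxE (negPf ji) andbF mul0r.
Qed.

Lemma dot0l (q : 'rV[R]_n) : dot 0 q = 0.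
Proof. by rewrite /dot big1 // => i _; rewrite mxE mul0r. Qed.

Lemma dotC (p q : 'rV[R]_n) : dot p q = dot q p.
Proof. by apply: eq_bigr => i _; rewrite mulrC. Qed.

Lemma differentiable_fst (z : 'rV[R]_n * 'rV[R]_n) : differentiable fst z.
Proof. by apply: linear_differentiable => y; exact: cvg_fst. Qed.

Lemma differentiable_snd (z : 'rV[R]_n * 'rV[R]_n) : differentiable snd z.
Proof. by apply: linear_differentiable => y; exact: cvg_snd. Qed.

(** Expand [v] in the standard basis: the differential is linear, and its values on the basis
    vectors are the directional derivatives collected by [grad]. *)
Lemma diffE_grad (f : 'rV[R]_n -> R) x v :
  differentiable f x -> 'd f x v = dot v (grad f x).
Proof.
move=> df; rewrite {1}(row_sum_delta v) linear_sum; apply: eq_bigr => i _.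
by rewrite linearZ mxE deriveE.
Qed.

Lemma is_derive_coord a x v i : differentiable a x ->
  is_derive x v (fun p => a p 0 i) ('D_v a x 0 i).
Proof.
move=> /(diff_derivable (v := v)) da.
apply: DeriveDef; [exact: (derivable_mxP _ _ _).1 da 0 i|].
by rewrite derive_mx // mxE.
Qed.

Lemma is_derive_dot a b x v : differentiable a x -> differentiable b x ->
  is_derive x v (fun p => dot (a p) (b p))
    (dot ('D_v a x) (b x) + dot (a x) ('D_v b x)).
Proof.
move=> da db.
(* Recast as a sum of products of functions, so that the sum and product rules apply coordinate by
   coordinate. *)
rewrite (_ : (fun p => _) =
  \sum_(i < n) ((fun p => a p 0 i) * (fun p => b p 0 i))); last first.
  by apply/funext => p; rewrite fct_sumE.
rewrite addrC /dot -big_split /=; apply: is_derive_sum => i.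
have := is_derive_coord a x v i da; have := is_derive_coord b x v i db.
move=> ib ia; apply: is_derive_eq.
by rewrite addrC /GRing.scale /= addrC [_ * b x 0 i]mulrC.
Qed.

(** Chain rule through the slices [l] and [r] of the product: pairing [u] with [D1] or [D2]
    evaluates ['d H] at [(u, 0)] or [(0, u)], and linearity of ['d H] adds the two contributions. *)
Lemma is_derive_pair_comp H a b x v :
  differentiable H (a x, b x) -> differentiable a x -> differentiable b x ->
  is_derive x v (fun p => H (a p, b p))
    (dot ('D_v a x) (D1 H (a x) (b x)) + dot ('D_v b x) (D2 H (a x) (b x))).
Proof.
move=> dH da db; set q := a x; set p := b x.
have dab : differentiable (fun y => (a y, b y)) x by exact: differentiable_pair.
pose l := fun y : 'rV[R]_n => (y, p); pose r := fun y : 'rV[R]_n => (q, y).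
have il : is_diff q l (fun u => (u, 0)).
  exact: is_diff_pair (is_diff_id q) (is_diff_cst p q).
have ir : is_diff p r (fun u => (0, u)).
  exact: is_diff_pair (is_diff_cst q p) (is_diff_id p).
have dl := @ex_diff _ _ _ _ _ _ _ il; have dr := @ex_diff _ _ _ _ _ _ _ ir.
have D1E u : dot u (D1 H q p) = 'd H (q, p) (u, 0).
  rewrite -[D1 H q p]/(grad (H \o l) q) -diffE_grad.
    by rewrite (diff_comp dl (dH : differentiable H (l q))) /=
      (@diff_val _ _ _ _ _ _ _ il).
  exact: differentiable_comp dl dH.
have D2E u : dot u (D2 H q p) = 'd H (q, p) (0, u).
  rewrite -[D2 H q p]/(grad (H \o r) p) -diffE_grad.
    by rewrite (diff_comp dr (dH : differentiable H (r p))) /=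
      (@diff_val _ _ _ _ _ _ _ ir).
  exact: differentiable_comp dr dH.
have dHab : differentiable (H \o (fun y => (a y, b y))) x.
  exact: differentiable_comp dab dH.
apply: DeriveDef; first exact: (diff_derivable dHab).
rewrite D1E D2E -linearD [LHS](deriveE _ dHab) (diff_comp dab dH) /=.
rewrite (diff_pair da db) /= (deriveE _ da) (deriveE _ db).
by congr ('d H _ (_, _)); rewrite /= ?addr0 ?add0r.
Qed.

End Calculus.

Section BoundaryValue.
Context {R : realType} {n : nat} {Q : set 'rV[R]_n}.
Context {H : 'rV[R]_n * 'rV[R]_n -> R} {q0 : 'rV[R]_n}.

(** Existence of a solution rules out the default curve of [xget]. *)
Lemma bv_solP k pk : unique_bv_solution Q H q0 k pk ->
  bv_solution Q H q0 k pk (bv_sol Q H q0 k pk).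
Proof.
by case=> -[c cP] _; apply: (@xgetPex _ _ (bv_solution Q H q0 k pk)); exists c.
Qed.

Lemma bv_sol_eq k pk c : unique_bv_solution Q H q0 k pk ->
  bv_solution Q H q0 k pk c ->
  forall l, (l <= k)%N -> bv_sol Q H q0 k pk l = c l.
Proof. by move=> U cP; apply: U.2 => //; exact: bv_solP. Qed.

Lemma eq_discrete_functional k (c c' : dcurve R n) :
  (forall l, (l <= k)%N -> c l = c' l) ->
  discrete_functional H k c = discrete_functional H k c'.
Proof.
move=> cc'; rewrite /discrete_functional cc' //; congr (_ - _).
by apply: eq_big_nat => l /andP[_ lk]; rewrite !cc' // ltnW.
Qed.

(** The new boundary term cancels the product in the last summand, leaving the value of [H] and the
    old boundary term. *)
Lemma discrete_functionalS k (c : dcurve R n) :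
  discrete_functional H k.+1 c = discrete_functional H k c
    + H ((c k).1, (c k.+1).2) - dot (c k).2 (c k).1.
Proof. by rewrite /discrete_functional big_nat_recr //=; ring. Qed.

(** First variation of the action. Hamilton's equations are imposed on the curve [g x] alone; the
    neighbouring curves are an arbitrary differentiable variation of it. *)
Lemma is_derive_discrete_functional k (g : 'rV[R]_n -> dcurve R n) x v :
  discrete_right_Hamiltonian Q H -> right_solution Q H k (g x) ->
  (forall l, (l <= k)%N -> differentiable (fun p => g p l) x) ->
  is_derive x v (fun p => discrete_functional H k (g p))
    (dot ('D_v (fun p => (g p k).2) x) (g x k).1
     + dot (g x 0%N).2 ('D_v (fun p => (g p 0%N).1) x)).
Proof.
move=> dH [gQ gE] dg.
have dg1 l : (l <= k)%N -> differentiable (fun p => (g p l).1) x.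
  move=> lk; apply: (@differentiable_comp _ _ _ _ (fun p => g p l) fst).
    exact: dg.
  exact: differentiable_fst.
have dg2 l : (l <= k)%N -> differentiable (fun p => (g p l).2) x.
  move=> lk; apply: (@differentiable_comp _ _ _ _ (fun p => g p l) snd).
    exact: dg.
  exact: differentiable_snd.
elim: k => [|k IH] in gQ gE dg dg1 dg2 *.
  rewrite (_ : (fun p => _) = (fun p => dot (g p 0%N).2 (g p 0%N).1)).
    by apply: is_derive_dot; [exact: dg2|exact: dg1].
  by apply/funext => p; rewrite /discrete_functional big_geq // subr0.
have kS : (k <= k.+1)%N by [].
have IHk := IH (fun l lk => gQ l (leqW lk)) (fun l lk => gE l (leqW lk))
  (fun l lk => dg l (leqW lk)) (fun l lk => dg1 l (leqW lk))
  (fun l lk => dg2 l (leqW lk)).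
have [q1E pE] := gE k (ltnSn k).
have dHk := is_derive_pair_comp H _ _ x v (dH _ _ (gQ _ kS))
  (dg1 _ kS) (dg2 _ (leqnn _)).
have dpq := is_derive_dot _ _ x v (dg2 _ kS) (dg1 _ kS).
rewrite (_ : (fun p => _) = (fun p => discrete_functional H k (g p))
    + (fun p => H ((g p k).1, (g p k.+1).2))
    - (fun p => dot (g p k).2 (g p k).1)).
  (* By Hamilton's equations [H] contributes dq_k . p_k + dp_{k+1} . q_{k+1}. Subtracting the
     variation of p_k . q_k removes dq_k . p_k and the term dp_k . q_k from the induction
     hypothesis. *)
  apply: is_derive_eq; rewrite -q1E -pE [dot ('D_v _ _) (g x k).2]dotC; ring.
by apply/funext => p; rewrite discrete_functionalS.
Qed.

Lemma grad_Sd (P : set 'rV[R]_n) k pk : open P -> P pk ->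
  discrete_right_Hamiltonian Q H ->
  (forall p, P p -> unique_bv_solution Q H q0 k p) ->
  (forall l, (l <= k)%N -> differentiable (fun p => bv_sol Q H q0 k p l) pk) ->
  grad (Sd Q H q0 k) pk = (bv_sol Q H q0 k pk k).1.
Proof.
move=> Popen Ppk dH U dsol.
(* The boundary conditions can be differentiated because they hold on a whole neighbourhood of
   [pk]. *)
have nP : \near pk, P pk by exact: open_nbhs_nbhs.
have [sol _ _] := bv_solP _ _ (U _ Ppk).
apply/rowP => i; rewrite mxE.
have [_ ->] := is_derive_discrete_functional k (bv_sol Q H q0 k) pk
  (delta_mx 0 i) dH sol dsol.
(* The end momentum of the chosen solution is its parameter, so it varies as the identity; the
   initial position stays at [q0]. *)
have -> v : 'D_v (fun p => (bv_sol Q H q0 k p k).2) pk = v.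
  rewrite (@near_eq_derive _ _ _ _ id) ?derive_id//.
  by near=> p; have [] := bv_solP k p (U p (near nP p _)).
have -> v : 'D_v (fun p => (bv_sol Q H q0 k p 0%N).1) pk = 0.
  rewrite (@near_eq_derive _ _ _ _ (cst q0)) ?derive_cst//.
  by near=> p; have [] := bv_solP k p (U p (near nP p _)).
by rewrite dot_delta dotC dot0l addr0.
Unshelve. all: by end_near. Qed.

End BoundaryValue.

Theorem theorem2 (R : realType) (n : nat) (Q : set 'rV[R]_n)
    (H : 'rV[R]_n * 'rV[R]_n -> R) (q0 : 'rV[R]_n)
    (P : nat -> set 'rV[R]_n)
    (Qopen : open Q) (Qq0 : Q q0)
    (Hdiff : discrete_right_Hamiltonian Q H)
    (Popen : forall k, open (P k))
    (Puniq : forall k pk, P k pk -> unique_bv_solution Q H q0 k pk)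
    (Pdiff : forall k pk, P k pk -> forall l, (l <= k)%N ->
       differentiable (fun p : 'rV[R]_n => bv_sol Q H q0 k p l) pk)
    (k : nat) (c : dcurve R n)
    (csol : right_solution Q H k.+1 c) (cq0 : (c 0%N).1 = q0)
    (cPk : P k (c k).2) (cPk1 : P k.+1 (c k.+1).2) :
  Sd Q H q0 k.+1 (c k.+1).2 - Sd Q H q0 k (c k).2 =
  H (grad (Sd Q H q0 k) (c k).2, (c k.+1).2)
  - dot (c k).2 (grad (Sd Q H q0 k) (c k).2).
Proof.
have bvS : bv_solution Q H q0 k.+1 (c k.+1).2 c by split.
(* Truncating [c] at time k gives the solution with end momentum p_k, so both actions can be
   evaluated on [c]. *)
have bvk : bv_solution Q H q0 k (c k).2 c.
  case: csol => cQ cE; split=> //.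
  by split=> l lk; [exact/cQ/leqW|exact/cE/leqW].
have solk := bv_sol_eq _ _ _ (Puniq _ _ cPk) bvk.
rewrite (grad_Sd (P k)) ?solk //; [|exact: Puniq|exact: Pdiff].
rewrite /Sd (eq_discrete_functional _ _ _ solk).
rewrite (eq_discrete_functional _ _ _ (bv_sol_eq _ _ _ (Puniq _ _ cPk1) bvS)).
by rewrite discrete_functionalS; ring.
Qed.
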